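(* Let $t_0\in\mathbb{R}$, let $\ell_1\in V_{t_0}$, $\sigma\in\Sigma$, $\ell_0\in V_{t_0}(\sigma)$, and let there exist $\kappa>0$ such that $f(v)(t)\ge0$ for a.e. $t\le t_0$ and every $v\in C_0(\mathbb{R};[0,\kappa])$. Let, moreover, there exist $\gamma\in AC_{loc}((-\infty,t_0];(0,+\infty))$ such that $$\gamma'(t)\le-\ell_1(\gamma)(t)\quad\text{and}\quad \ell_0(1)(t)\ge\frac{\ell_1(\gamma)(t)}{\gamma(t)}\qquad\text{for a.e. }t\le t_0,$$ $$\sup\left\{\int_{\sigma(t)}^t\frac{\ell_1(\gamma)(s)}{\gamma(s)}\,ds:\ t\le t_0\right\}<+\infty.$$ Then every solution $u$ to $u'(t)=\ell_0(u)(t)-\ell_1(u)(t)+f(u)(t)$ on $(-\infty,t_0]$ satisfying $0\le u(t)\le\kappa$ for $t\le t_0$ has a finite limit $u(-\infty)$.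
   Context: Notation. $\mathbb{R}_+=[0,+\infty)$. $C_{loc}(\mathbb{R};\mathbb{R})$ is the space of continuous functions $\mathbb{R}\to\mathbb{R}$ with the topology of uniform convergence on every compact interval. $L_{loc}(\mathbb{R};\mathbb{R})$ is the space of locally Lebesgue-integrable functions on $\mathbb{R}$ with the topology of convergence in the mean on every compact interval. For $I,D\subseteq\mathbb{R}$: $C_0(I;D)$ is the set of bounded continuous functions $I\to D$; $AC_{loc}(I;D)$ is the set of functions $I\to D$ absolutely continuous on every compact interval contained in $I$; $L_{loc}(\mathbb{R};\mathbb{R}_+)$ is the set of functions $\mathbb{R}\to\mathbb{R}_+$ integrable on every compact interval. $u(-\infty)$ denotes the limit of $u$ at $-\infty$, if it exists. Standing assumptions. $\ell_0,\ell_1:C_{loc}(\mathbb{R};\mathbb{R})\to L_{loc}(\mathbb{R};\mathbb{R})$ are linear continuous operators which are positive (map non-negative functions to non-negative functions). $f:C_{loc}(\mathbb{R};\mathbb{R})\to L_{loc}(\mathbb{R};\mathbb{R})$ is a continuous operator satisfying the local Carathéodory conditions: for every $r>0$ there is $q_r\in L_{loc}(\mathbb{R};\mathbb{R}_+)$ with $|f(v)(t)|\le q_r(t)$ for a.e. $t\in\mathbb{R}$ whenever $\sup_{\mathbb{R}}|v|\le r$. If $I\subseteq\mathbb{R}$ is a closed interval, $u:I\to\mathbb{R}$ is continuous and $T:C_{loc}(\mathbb{R};\mathbb{R})\to L_{loc}(\mathbb{R};\mathbb{R})$ is a continuous operator, then $T(u):=T(\vartheta(u))$, where $\vartheta(u)$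 is the extension of $u$ to $\mathbb{R}$ equal to $u(\inf I)$ to the left of $I$ (if $\inf I>-\infty$) and $u(\sup I)$ to the right of $I$ (if $\sup I<+\infty$). $T(1)$ is the value of $T$ at the constant function $1$. For $\tau\in\mathbb{R}$, $V_\tau$ is the set of continuous operators $T:C_{loc}(\mathbb{R};\mathbb{R})\to L_{loc}(\mathbb{R};\mathbb{R})$ such that for every $\zeta\le\tau$, $T(u)(t)=T(v)(t)$ for a.e. $t\le\zeta$ whenever $u,v\in C_{loc}(\mathbb{R};\mathbb{R})$ and $u=v$ on $(-\infty,\zeta]$. $\Sigma$ is the set of continuous $\sigma:\mathbb{R}\to\mathbb{R}$ with $\sigma(t)\le t$ for all $t$. For $\sigma\in\Sigma$, $V_\tau(\sigma)$ is the set of continuous operators $T:C_{loc}(\mathbb{R};\mathbb{R})\to L_{loc}(\mathbb{R};\mathbb{R})$ such that, for a.e. $t\le\tau$, $T(u)(t)=T(v)(t)$ whenever $u,v\in C_{loc}(\mathbb{R};\mathbb{R})$ satisfy $u(s)=v(s)$ for $s\in[\sigma(t),t]$. A solution of the equation on a closed interval $I$ is a function $u:I\to\mathbb{R}$ absolutely continuous on every compact interval contained in $I$ and satisfying the equation a.e. on $I$ (with $\ell_0(u),\ell_1(u),f(u)$ understood via the extension $\vartheta(u)$). *)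

(* Defs.v *)
From HB Require Import structures.
From mathcomp Require Import all_boot all_order all_algebra.
From mathcomp Require Import all_classical all_reals all_analysis.

Set Implicit Arguments.
Unset Strict Implicit.
Unset Printing Implicit Defensive.

Import Order.TTheory GRing.Theory Num.Theory.
Import numFieldNormedType.Exports.

Local Open Scope classical_set_scope.
Local Open Scope ring_scope.

Definition C_loc (R : realType) : set (R -> R) := [set u | continuous u].
Arguments C_loc : clear implicits.

(* Elements of L_loc are handled through representatives: every condition below
   on an element of L_loc is imposed almost everywhere or under an integral.
   [locally_integrable] asks for Borel measurability, which is no restriction
   because every class has a Borel representative. *)
Definition L_loc (R : realType) : set (R -> R) :=
  [set g | locally_integrable setT g].
Arguments L_loc : clear implicits.

(* Operators C_loc -> L_loc. Only the values at continuous functions matter. *)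
Definition operator (R : realType) := (R -> R) -> (R -> R).

(* The neighbourhoods of u in C_loc are the traces on C_loc of those in the
   topology of uniform convergence on compact sets; convergence of T v to T u in
   L_loc is convergence of the integral of |T v - T u| over each `[a, b] to 0. *)
Definition continuous_operator (R : realType) (T : operator R) : Prop :=
  (forall u, C_loc R u -> L_loc R (T u)) /\
  (forall u, C_loc R u -> forall a b : R,
    (\int[@lebesgue_measure R]_(t in `[a, b]) `|T v t - T u t|%:E)%E
      @[v --> within (C_loc R) (nbhs (u : {family compact, R -> R}))]
    --> (0 : \bar R)).

Definition linear_operator (R : realType) (T : operator R) : Prop :=
  forall (c : R) (u v : R -> R), C_loc R u -> C_loc R v ->
    {ae @lebesgue_measure R, forall t : R,
      T (fun s => c * u s + v s) t = c * T u t + T v t}.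

Definition positive_operator (R : realType) (T : operator R) : Prop :=
  forall u : R -> R, C_loc R u -> (forall t, 0 <= u t) ->
    {ae @lebesgue_measure R, forall t : R, 0 <= T u t}.

Definition local_caratheodory (R : realType) (T : operator R) : Prop :=
  forall r : R, 0 < r ->
    exists2 q : R -> R, L_loc R q /\ (forall t, 0 <= q t) &
      forall v : R -> R, C_loc R v -> (forall t, `|v t| <= r) ->
        {ae @lebesgue_measure R, forall t : R, `|T v t| <= q t}.

(* Bounded continuous functions on the whole line with values in D. *)
Definition C_0 (R : realType) (D : set R) : set (R -> R) :=
  [set v | [/\ continuous v, bounded_fun v & forall t, D (v t)]].

Definition absolutely_continuous (R : realType) (a b : R) (g : R -> R) : Prop :=
  forall e : R, 0 < e -> exists2 d : R, 0 < d &
    forall (n : nat) (x y : 'I_n -> R),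
      (forall i, [/\ a <= x i, x i <= y i & y i <= b]) ->
      trivIset setT (fun i => `]x i, y i[%classic) ->
      \sum_i (y i - x i) < d ->
      \sum_i `|g (y i) - g (x i)| < e.

(* A function I -> D is represented by a total function; its values outside I
   are irrelevant. *)
Definition AC_loc (R : realType) (I D : set R) : set (R -> R) :=
  [set g | (forall t, I t -> D (g t)) /\
           (forall a b : R, `[a, b] `<=` I -> absolutely_continuous a b g)].

(* The extension of u : ]-oo, t0] -> R to the line, constant on [t0, +oo[. *)
Definition vartheta (R : realType) (t0 : R) (u : R -> R) : R -> R :=
  fun t => u (Num.min t t0).

Definition V (R : realType) (tau : R) : set (operator R) :=
  [set T | continuous_operator T /\
    forall zeta : R, zeta <= tau ->
    forall u v : R -> R, C_loc R u -> C_loc R v ->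
      (forall s, s <= zeta -> u s = v s) ->
      {ae @lebesgue_measure R, forall t : R, t <= zeta -> T u t = T v t}].

Definition Sigma (R : realType) : set (R -> R) :=
  [set sigma | continuous sigma /\ forall t, sigma t <= t].
Arguments Sigma : clear implicits.

(* T u and T v are classes modulo null sets, so the exceptional set of t is
   allowed to depend on u and v. *)
Definition V_delay (R : realType) (tau : R) (sigma : R -> R) :
    set (operator R) :=
  [set T | continuous_operator T /\
    forall u v : R -> R, C_loc R u -> C_loc R v ->
      {ae @lebesgue_measure R, forall t : R, t <= tau ->
        (forall s, sigma t <= s <= t -> u s = v s) -> T u t = T v t}].

(* Solutions on ]-oo, t0] of u' = l0(u) - l1(u) + f(u). *)
Definition solution (R : realType) (l0 l1 f : operator R) (t0 : R)
    (u : R -> R) : Prop :=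
  AC_loc `]-oo, t0] setT u /\
  {ae @lebesgue_measure R, forall t : R, t <= t0 ->
    is_derive t 1 u (l0 (vartheta t0 u) t - l1 (vartheta t0 u) t
                     + f (vartheta t0 u) t)}.

(* Main.v *)
Require Import Defs.
From HB Require Import structures.
From mathcomp Require Import all_boot all_order all_algebra.
From mathcomp Require Import all_classical all_reals all_analysis.
From mathcomp Require Import measurable_realfun.
From mathcomp Require Import ring lra.

Import Order.TTheory GRing.Theory Num.Theory.
Import numFieldNormedType.Exports.

Local Open Scope classical_set_scope.
Local Open Scope ring_scope.

(** The limit is the infimum [a] of [u] on the half-line. The reason is that
    [z = u - a] satisfies a Harnack inequality: there is a constant
    [c > 0] with [c * z s <= z t] whenever [s <= t <= t0]. A point where [z] is
    small then makes [z] small everywhere to its left ([cvg_ninfty_inf]).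

    Write [q = l1 gamma / gamma]. As [gamma] is nonincreasing and [l1] is a
    positive Volterra operator, [l1 1 <= q], while [q <= l0 1] by hypothesis; as
    moreover [a >= 0] and [f u >= 0], it follows that [z' >= l0 z - l1 z]. The key
    point is to replace the nonlocal term [l1 z] by the local one [q * z]. Since
    [l0 z >= 0], both [z' >= - l1 z] and [gamma' <= - l1 gamma] hold, and
    [solution_ratio_nondecreasing] deduces that [z / gamma] is nondecreasing:
    before time [t], [z] lies below [z t / gamma t * gamma]. Applying [l1], which
    only looks at the past, gives [l1 z <= q * z] ([volterra_le_ratio]).

    What remains is the scalar inequality [z' >= q * (m - z)], valid as soon as
    [m] is a nonnegative lower bound of [z] on the delay window between [sigma t]
    and [t], whose weight for [q] is bounded by a constant [K]. The Harnack
    inequality follows with [c = expR (- (K + 1))] ([delay_harnack]).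

    Differential inequalities hold almost everywhere only. They are all
    integrated through [ac_nondecreasing]. *)

(** * Monotonicity of absolutely continuous functions *)

Lemma is_derive_dist_lt {R : realType} (g : R -> R) (c d e : R) :
  is_derive c 1 g d -> 0 < e ->
  exists2 r : R, 0 < r & forall t, `|t - c| < r ->
    `|g t - g c - d * (t - c)| <= e * `|t - c|.
Proof.
move=> gd e0.
have gcvg : (fun h => h^-1 *: (g (h *: 1 + c) - g c)) @ 0^' --> d.
  have dg : derivable g c 1 by apply: ex_derive.
  have <- : 'D_1 g c = d by apply: derive_val.
  exact: dg.
move/cvgrPdist_lt : gcvg => /(_ e e0); rewrite near_withinE.
case=> r /= r0 rP; exists r => // t tr.
have [->|tc] := eqVneq t c; first by rewrite !subrr mulr0 subrr !normr0 mulr0.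
have h0 : t - c != 0 by rewrite subr_eq0.
have := rP (t - c); rewrite /ball_ /= sub0r normrN => /(_ tr h0).
rewrite /GRing.scale /= mulr1 subrK => /ltW H.
have -> : g t - g c - d * (t - c) =
    - ((d - (t - c)^-1 * (g t - g c)) * (t - c)).
  by field.
by rewrite normrN normrM ler_wpM2r.
Qed.

(** The invariant of the sweep from [a] to the right in [ac_nondecreasing]: up to
    [t] the function has lost at most the slope [e], except over finitely many
    disjoint intervals contained in [U], whose total contribution absolute
    continuity will make small. *)
Definition increment_bounded {R : realType} (g : R -> R) (a : R) (U : set R)
    (e t : R) :=
  exists n (x y : 'I_n -> R),
    [/\ forall i, [/\ a <= x i, x i <= y i & y i <= t],
        trivIset setT (fun i => `]x i, y i[%classic),
        forall i, `]x i, y i[%classic `<=` U &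
        - e * (t - a) - \sum_i `|g (y i) - g (x i)| <= g t - g a].

Lemma increment_bounded_start {R : realType} (g : R -> R) (a : R) (U : set R)
    (e : R) :
  increment_bounded g a U e a.
Proof.
exists 0, (fun=> a), (fun=> a); split=> // [[]//|[]//|].
by rewrite big_ord0 !subrr mulr0 subrr.
Qed.

Lemma increment_bounded_good {R : realType} (g : R -> R) (a : R) (U : set R)
    (e t t' : R) :
  t <= t' -> - e * (t' - t) <= g t' - g t ->
  increment_bounded g a U e t -> increment_bounded g a U e t'.
Proof.
move=> tt' H [n [x [y [xy tri sub le]]]]; exists n, x, y; split => //.
  by move=> i; have [? ? yt] := xy i; split => //; apply: le_trans tt'.
by lra.
Qed.

Lemma increment_bounded_cover {R : realType} (g : R -> R) (a : R) (U : set R)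
    (e t t' : R) :
  0 <= e -> a <= t -> t <= t' -> `]t, t'[%classic `<=` U ->
  increment_bounded g a U e t -> increment_bounded g a U e t'.
Proof.
move=> e0 ta tt' ttU [n [x [y [xy tri sub le]]]].
exists n.+1, (fun i => oapp x t (unlift ord0 i)),
             (fun i => oapp y t' (unlift ord0 i)); split.
- move=> i; case: unliftP => [j _|_] /=; last by [].
  by have [? ? yt] := xy j; split => //; apply: le_trans tt'.
- have disj j : `]x j, y j[%classic `&` `]t, t'[%classic = set0.
    rewrite -subset0 => z /= [+ +].
    rewrite !in_itv /= => /andP[_ zy] /andP[tz _].
    have [_ _ yt] := xy j; lra.
  move=> i j _ _; case: unliftP => [i' ->|->]; case: unliftP => [j' ->|->] //=.
  + by move=> /tri -> .
  + by rewrite disj => -[].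
  + by rewrite setIC disj => -[].
- by move=> i; case: unliftP => [j _|_] //=.
- rewrite big_ord_recl unlift_none /=.
  under eq_bigr do rewrite liftK /=.
  have := ler_norm (- (g t' - g t)); rewrite normrN.
  have := mulr_ge0 e0 (_ : 0 <= t' - t); rewrite subr_ge0 => /(_ tt').
  lra.
Qed.

(** An absolutely continuous function whose derivative is almost everywhere
    nonnegative is nondecreasing. Let [e > 0] and cover the exceptional null set
    by an open set [U] of measure less than the modulus of absolute continuity
    for [e]. Every point of [`[a, b]] has a neighbourhood across which the bound
    [increment_bounded] propagates: the slope bound does it at a good point, a
    new interval inside [U] at an exceptional one. So the supremum of the points
    reached is [b], and the intervals collected on the way cost less than [e]. *)
Lemma ac_nondecreasing {R : realType} (g : R -> R) (a b : R) : a <= b ->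
  absolutely_continuous a b g ->
  {ae @lebesgue_measure R, forall t, a < t < b ->
     exists2 d, is_derive t 1 g d & 0 <= d} ->
  g a <= g b.
Proof.
move=> ab gac [N [mN N0 Nsub]].
suff key e : 0 < e -> - e * (b - a + 1) <= g b - g a.
  rewrite -subr_ge0; apply/ler_addgt0Pr => e e0.
  have l0 : 0 < b - a + 1 by lra.
  have := key _ (divr_gt0 e0 l0); rewrite mulNr divfK ?lt0r_neq0//.
  lra.
move=> e0; have [d d0 dP] := gac _ e0.
(* The end points, where no derivative is assumed, join the exceptional set. *)
pose N' := N `|` [set a; b].
have mN' : measurable N' by apply: measurableU => //; apply: measurableU.
have N'0 : lebesgue_measure N' = 0%E.
  have ab0 : lebesgue_measure [set a; b] = 0%E :> \bar R.
    rewrite measureU0; [exact: lebesgue_measure_set1|by []|by []|].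
    exact: lebesgue_measure_set1.
  rewrite measureU0; [exact: N0|by []| |exact: ab0].
  by apply: measurableU; exact: measurable_set1.
have N'oo : (lebesgue_measure N' < +oo)%E by rewrite [ltLHS]N'0 ltry.
have [U [oU N'U mUd]] := lebesgue_regularity_outer mN' N'oo d0.
have {}mUd : (lebesgue_measure U < d%:E)%E.
  have mU : measurable U by apply: open_measurable.
  rewrite -(setDUK N'U); apply: le_lt_trans (measureU2 _ _ _) _ => //.
    exact: measurableD.
  by rewrite [X in (X + _)%E]N'0 add0e.
have local c : a <= c <= b -> exists2 r : R, 0 < r & forall t t',
    a <= t -> c - r < t -> t <= c -> c <= t' -> t' < c + r ->
    increment_bounded g a U e t -> increment_bounded g a U e t'.
  move=> cab.
  have [cU|cU] := pselect (U c).
    have [r /= r0 rU] : nbhs_ball c U by apply/nbhs_ballP; exact: open_nbhs_nbhs.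
    exists r => // t t' at_ crt tc ct' ctr'.
    apply: increment_bounded_cover => //; [exact: ltW|exact: le_trans ct'|].
    move=> z /=; rewrite in_itv /= => /andP[tz zt']; apply: rU.
    by rewrite /ball /= ltr_distl; lra.
  have [dc cd dc0] : exists2 d, is_derive c 1 g d & 0 <= d.
    apply: contrapT => nd; apply/cU/N'U.
    have [->|ca] := eqVneq c a; first by right; left.
    have [->|cb] := eqVneq c b; first by right; right.
    left; apply: Nsub => /= H; apply: nd; apply: H.
    by rewrite !lt_neqAle eq_sym ca cb.
  have [r r0 rP] := is_derive_dist_lt g c dc e cd e0; exists r => // t t' _.
  move=> crt tc ct' ctr'; apply: increment_bounded_good.
    exact: le_trans ct'.
  have /rP : `|t - c| < r by rewrite ler0_norm; lra.
  have /rP : `|t' - c| < r by rewrite ger0_norm; lra.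
  rewrite (ger0_norm (_ : 0 <= t' - c)) ?subr_ge0//.
  rewrite (ler0_norm (_ : t - c <= 0)) ?subr_le0//.
  rewrite !ler_norml => /andP[H1 _] /andP[_ H2].
  have : 0 <= dc * (t' - c) by rewrite mulr_ge0// subr_ge0.
  have : 0 <= dc * (c - t) by rewrite mulr_ge0// subr_ge0.
  lra.
pose S := [set t | a <= t <= b /\ increment_bounded g a U e t].
have Sa : S a by split; [rewrite lexx|exact: increment_bounded_start].
have Sb : has_sup S.
  by split; [exists a|exists b => t [/andP[]]].
have ac : a <= sup S by apply: ub_le_sup => //; case: Sb.
have cb : sup S <= b by apply: ge_sup; [exists a|move=> t [/andP[]]].
(* A point of S close to its supremum lets the bound cross the supremum, so that
   the supremum can only be b, and b itself is reached. *)
have [r r0 rP] := local (sup S) (introT andP (conj ac cb)).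
have [t [tab tS] tr] := sup_adherent r0 Sb.
have tsup : t <= sup S by apply: ub_le_sup; [case: Sb|].
pose t' := Num.min b (sup S + r / 2).
have t'P : sup S <= t' by rewrite /t' le_min cb; lra.
have St' : S t'.
  split; first by rewrite (le_trans ac t'P) ge_min lexx.
  apply: (rP t) => //; first by case/andP : tab.
  by rewrite /t' gt_min; apply/orP; right; lra.
have t'b : t' = b.
  have : t' <= sup S by apply: ub_le_sup => //; case: Sb.
  by rewrite /t'; case: (ltP b) => // _; rewrite leNgt ltrDl divr_gt0.
have [_ [n [x [y [xy tri sub le]]]]] := St'; rewrite t'b in xy le.
suff : \sum_i `|g (y i) - g (x i)| < e by lra.
apply: dP => //.
rewrite -lte_fin; apply: le_lt_trans mUd.
rewrite -sumEFin.
rewrite (eq_bigr (fun i => lebesgue_measure `]x i, y i[%classic)); last first.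
  move=> i _; rewrite lebesgue_measure_itv /= lte_fin.
  by have [_ xyi _] := xy i; case: ltgtP xyi => // -> _; rewrite subrr.
rewrite -measure_semi_additive_ord//; last exact: bigsetU_measurable.
apply: le_measure; rewrite ?inE; [exact: bigsetU_measurable|exact: open_measurable|].
by apply: (big_ind (fun A => A `<=` U)) => [//|A B AU BU z [/AU|/BU]|i _].
Qed.

(** * Closure properties of absolute continuity *)

(** The one closure principle from which the absolute continuity of linear
    combinations, products of bounded functions and compositions with locally
    Lipschitz functions is read off. *)
Lemma ac_dominated {R : realType} (f g h : R -> R) (a b C : R) : 0 <= C ->
  absolutely_continuous a b f -> absolutely_continuous a b g ->
  (forall x y, a <= x -> x <= y -> y <= b ->
     `|h y - h x| <= C * (`|f y - f x| + `|g y - g x|)) ->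
  absolutely_continuous a b h.
Proof.
move=> C0 fac gac hfg e e0.
have e'0 : 0 < e / (2 * (C + 1)) by rewrite divr_gt0//; lra.
have [d1 d10 d1P] := fac _ e'0; have [d2 d20 d2P] := gac _ e'0.
exists (Num.min d1 d2); first by rewrite lt_min d10.
move=> n x y xy tri; rewrite lt_min => /andP[lt1 lt2].
have {d1P lt1} := d1P n x y xy tri lt1.
have {d2P lt2} := d2P n x y xy tri lt2.
set G := \sum_i `|g (y i) - g (x i)|; set F := \sum_i `|f (y i) - f (x i)|.
move=> Ge Fe.
apply: (@le_lt_trans _ _ (C * (F + G))).
  rewrite -big_split mulr_sumr; apply: ler_sum => i _.
  by have [? ? ?] := xy i; exact: hfg.
have FG : F + G <= e / (C + 1).
  have -> : e / (C + 1) = e / (2 * (C + 1)) + e / (2 * (C + 1)) by field; lra.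
  by rewrite ltW// ltrD.
apply: (@le_lt_trans _ _ (C * (e / (C + 1)))); first by rewrite ler_wpM2l.
by rewrite mulrCA gtr_pMr// ltr_pdivrMr; lra.
Qed.

Lemma ac_uniformly_continuous {R : realType} (a b : R) (g : R -> R) :
  absolutely_continuous a b g ->
  forall e, 0 < e -> exists2 d, 0 < d &
    forall s t, a <= s <= b -> a <= t <= b -> `|t - s| < d -> `|g t - g s| < e.
Proof.
move=> gac e e0; have [d d0 dP] := gac e e0; exists d => // s t.
wlog st : s t / s <= t.
  move=> H sab tab; have [st|/ltW ts] := leP s t; first exact: H.
  by rewrite !(distrC _ s) !(distrC _ (g s)); exact: H.
move=> /andP[as_ _] /andP[_ tb]; rewrite ger0_norm ?subr_ge0// => lt.
have := dP 1%N (fun=> s) (fun=> t); rewrite !big_ord1; apply => //.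
by move=> i j _ _ _; rewrite !ord1.
Qed.

Lemma ac_subinterval {R : realType} (a b a' b' : R) (g : R -> R) :
  a <= a' -> b' <= b -> absolutely_continuous a b g ->
  absolutely_continuous a' b' g.
Proof.
move=> aa' bb' gac e e0; have [d d0 dP] := gac e e0; exists d => // n x y xy.
apply: dP => i; have [ax ? yb] := xy i.
by split; [exact: le_trans ax| |exact: le_trans bb'].
Qed.

(** * Primitives and a Gronwall inequality *)

Lemma locally_integrable_itv {R : realType} (q : R -> R) (a b : R) :
  locally_integrable setT q ->
  (@lebesgue_measure R).-integrable `[a, b] (EFin \o q).
Proof.
move=> [mq _ qi]; apply/integrableP; split.
  by apply/measurable_EFinP; exact: measurable_funTS.
by apply: qi => //; exact: segment_compact.
Qed.

Lemma le_Rintegral_subitv {R : realType} (q : R -> R) (a b a' b' : R) :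
  (forall t, 0 <= q t) -> locally_integrable setT q -> a' <= a -> b <= b' ->
  \int[@lebesgue_measure R]_(t in `[a, b]) q t <=
  \int[@lebesgue_measure R]_(t in `[a', b']) q t.
Proof.
move=> q0 qi aa' bb'; apply: fine_le.
- by apply: integrable_fin_num => //; exact: locally_integrable_itv.
- by apply: integrable_fin_num => //; exact: locally_integrable_itv.
apply: ge0_subset_integral => //.
- by apply: (measurable_int (@lebesgue_measure R)); exact: locally_integrable_itv.
- by move=> t _ /=; rewrite lee_fin.
- by apply: subset_itv; rewrite bnd_simp.
Qed.

Lemma locally_integrable_mul_norm {R : realType} (f h : R -> R) (C : R) :
  locally_integrable setT f -> measurable_fun setT h ->
  (forall t, 0 <= h t <= C) ->
  locally_integrable setT (fun t => h t * `|f t|).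
Proof.
move=> [mf oT fi] mh hC.
have mhf : measurable_fun setT (fun t => h t * `|f t|).
  by apply: measurable_funM => //; exact: measurableT_comp.
split => // A _ cA; have mA : measurable A by exact: compact_measurable.
have C0 : 0 <= C by have /andP[h0 hC0] := hC 0; exact: le_trans hC0.
apply: (@le_lt_trans _ _ (\int[lebesgue_measure]_(x in A) (C%:E * `|f x|%:E))%E).
  apply: ge0_le_integral => //.
  - apply/measurable_EFinP; apply: measurable_funTS; exact: measurableT_comp.
  - apply/measurable_EFinP; apply: measurable_funTS.
    by apply: measurable_funM => //; exact: measurableT_comp.
  - move=> x _; have /andP[h0 hxC] := hC x.
    by rewrite -EFinM lee_fin normrM normr_id (ger0_norm h0) ler_wpM2r.
rewrite ge0_integralZl_EFin//.
  by rewrite lte_mul_pinfty ?lee_fin// fi.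
by apply/measurable_EFinP; apply: measurable_funTS; exact: measurableT_comp.
Qed.

(** The increments of the primitive over disjoint intervals add up to the integral
    over their union, which is small when the union has small measure. *)
Lemma ac_parameterized_integral {R : realType} (q : R -> R) (a b : R) :
  (forall t, 0 <= q t) ->
  (@lebesgue_measure R).-integrable `[a, b] (EFin \o q) ->
  absolutely_continuous a b
    (fun x => \int[@lebesgue_measure R]_(t in `[a, x]) q t).
Proof.
move=> q0 qi e e0.
have qabi : (@lebesgue_measure R).-integrable setT (EFin \o (q \_ `[a, b])).
  by rewrite -restrict_EFin; apply/integrable_restrict => //=; rewrite setTI.
have [d [d0 dP]] := integral_normr_continuous qabi e0.
exists d => // n x y xy tri lt.
pose D := \big[setU/set0]_i `]x i, y i[%classic.
have mD : measurable D by apply: bigsetU_measurable.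
have Dab : D `<=` `[a, b].
  apply: (big_ind (fun A => A `<=` `[a, b])) => [//|A B AU BU z [/AU|/BU]//|i _].
  have [axi _ yib] := xy i; apply: subset_itv; rewrite bnd_simp //.
have muD : (lebesgue_measure D < d%:E)%E.
  rewrite measure_semi_additive_ord// (eq_bigr (fun i => (y i - x i)%:E)).
    by rewrite sumEFin lte_fin.
  move=> i _; rewrite [LHS]lebesgue_measure_itv /= lte_fin.
  by have [_ xyi _] := xy i; case: ltgtP xyi => // -> _; rewrite subrr.
have /le_lt_trans -> // := dP D mD muD.
rewrite -lee_fin /Rintegral.
have sub i : `]x i, y i]%classic `<=` `[a, b].
  by have [axi _ yib] := xy i; apply: subset_itv; rewrite bnd_simp.
have subo i : `]x i, y i[%classic `<=` `[a, b].
  by have [axi _ yib] := xy i; apply: subset_itv; rewrite bnd_simp.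
have incr i : `|\int[@lebesgue_measure R]_(t in `[a, y i]) q t -
                \int[@lebesgue_measure R]_(t in `[a, x i]) q t|%:E =
    (\int[@lebesgue_measure R]_(t in `]x i, y i[) (q t)%:E)%E.
  have [axi xyi yib] := xy i.
  rewrite Rintegral_itvB ?bnd_simp//; last first.
    by apply: integrableS qi => //; apply: subset_itvl; rewrite bnd_simp.
  rewrite ger0_norm ?Rintegral_ge0// -Rintegral_itv_bndo_bndc; last first.
    exact: integrableS qi.
  by rewrite /Rintegral fineK//; apply: integrable_fin_num => //; exact: integrableS qi.
rewrite -sumEFin (eq_bigr _ (fun i _ => incr i)).
have -> : (\int[@lebesgue_measure R]_(t in D) `|(q \_ `[a, b]) t|%:E)%E =
   (\int[@lebesgue_measure R]_(t in D) (q t)%:E)%E.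
  apply: eq_integral => t; rewrite inE => Dt.
  by rewrite patchE mem_set; [rewrite ger0_norm|exact: Dab].
rewrite fineK; last by apply: integrable_fin_num => //; exact: integrableS qi.
rewrite integral_bigsetU_EFin ?index_enum_uniq//.
- by apply: sub_trivIset tri.
- by apply: (measurable_int (@lebesgue_measure R)); exact: integrableS qi.
Qed.

(** Lets the filter lemmas combine statements that hold almost everywhere for
    Lebesgue measure. *)
#[local] Instance ae_lebesgue_filter {R : realType} :
  Filter (almost_everywhere (@lebesgue_measure R)) :=
  ae_filter_ringOfSetsType (@lebesgue_measure R).

(** From [z' >= q * (m - z)] the function [(z - m) * expR P], with [P] the
    primitive of [q], has an almost everywhere nonnegative derivative. The base
    point [s] of the primitive is kept apart from [b] because the estimate is
    applied on different intervals with one primitive. *)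
Lemma gronwall_lower {R : realType} (z q : R -> R) (m M s b t : R) :
  s <= b -> b <= t ->
  (forall r, 0 <= q r) -> locally_integrable setT q ->
  absolutely_continuous b t z -> (forall r, b <= r <= t -> `|z r - m| <= M) ->
  {ae @lebesgue_measure R, forall r, b < r < t ->
     exists2 d, is_derive r 1 z d & q r * (m - z r) <= d} ->
  (z b - m) * expR (\int[@lebesgue_measure R]_(r in `[s, b]) q r) <=
  (z t - m) * expR (\int[@lebesgue_measure R]_(r in `[s, t]) q r).
Proof.
move=> sb bt q0 qi zac zM zder.
pose P x := \int[@lebesgue_measure R]_(r in `[s, x]) q r.
have M0 : 0 <= M by apply: le_trans (zM b _); rewrite ?normr_ge0// lexx.
have PP x y : x <= y -> P x <= P y by move=> xy; exact: le_Rintegral_subitv.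
have Pac : absolutely_continuous b t P.
  apply: (ac_subinterval s t) => //; apply: ac_parameterized_integral => //.
  exact: locally_integrable_itv.
have expP x y : b <= x -> x <= y -> y <= t ->
    `|expR (P y) - expR (P x)| <= expR (P t) * `|P y - P x|.
  move=> bx xy yt; rewrite !ger0_norm ?subr_ge0 ?ler_expR ?PP//.
  have -> : expR (P x) = expR (P y) * expR (P x - P y).
    by rewrite -expRD addrCA subrr addr0.
  rewrite -[X in X - _]mulr1 -mulrBr.
  have e1 : 1 - expR (P x - P y) <= P y - P x.
    by have := expR_ge1Dx (P x - P y); lra.
  apply: (@le_trans _ _ (expR (P y) * (P y - P x))).
    by rewrite ler_wpM2l// expR_ge0.
  by rewrite ler_wpM2r ?subr_ge0 ?PP// ler_expR PP.
apply: (ac_nondecreasing (fun x => (z x - m) * expR (P x)) b t bt).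
  apply: (ac_dominated z P _ _ _ (expR (P t) * (1 + M))) => //.
    by rewrite mulr_ge0 ?expR_ge0//; lra.
  move=> x y bx xy yt.
  have -> : (z y - m) * expR (P y) - (z x - m) * expR (P x) =
     (z y - m) * (expR (P y) - expR (P x)) + expR (P x) * (z y - z x) by ring.
  apply: le_trans (ler_normD _ _) _; rewrite !normrM (ger0_norm (expR_ge0 _)).
  have H1 : `|z y - m| * `|expR (P y) - expR (P x)| <=
            M * (expR (P t) * `|P y - P x|).
    by rewrite ler_pM ?normr_ge0 ?expP// zM// (le_trans bx).
  have H2 : expR (P x) * `|z y - z x| <= expR (P t) * `|z y - z x|.
    by rewrite ler_wpM2r// ler_expR PP// (le_trans xy).
  have H3 : 0 <= expR (P t) * `|P y - P x| by rewrite mulr_ge0 ?expR_ge0.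
  have H4 : 0 <= M * (expR (P t) * `|z y - z x|).
    by rewrite !mulr_ge0 ?expR_ge0.
  have -> : expR (P t) * (1 + M) * (`|z y - z x| + `|P y - P x|) =
    expR (P t) * `|z y - z x| + expR (P t) * `|P y - P x| +
    M * (expR (P t) * `|z y - z x|) + M * (expR (P t) * `|P y - P x|) by ring.
  lra.
have := FTC1 (a := BLeft s) (fun y => locally_integrable_itv q s y qi) qi.
apply: filterS2 zder => r zder + /andP[br rt].
case: zder => [|d zd dle]; first by rewrite br.
case; first by rewrite lte_fin; lra.
move=> Pd Pr.
have PD : is_derive r 1 P (q r) by split; [exact: Pd|rewrite -derive1E].
exists ((z r - m) * (expR (P r) * q r) + expR (P r) * d).
  have eD : is_derive r 1 (expR \o P) (expR (P r) * q r).
    by have := @is_derive1_comp R expR P r _ _ (is_derive_expR (P r)) PD; rewrite mulrC.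
  have zD : is_derive r 1 (fun x => z x - m) d.
    have := is_deriveB zd (is_derive_cst m r 1); rewrite subr0; apply.
  exact: is_deriveM.
have -> : (z r - m) * (expR (P r) * q r) + expR (P r) * d =
  expR (P r) * (d - q r * (m - z r)) by ring.
by rewrite mulr_ge0 ?expR_ge0// subr_ge0.
Qed.

(** * Constant extension from a half-line *)

Lemma AC_loc_vartheta_continuous {R : realType} (t0 : R) (D : set R)
  (g : R -> R) : AC_loc `]-oo, t0] D g -> continuous (vartheta t0 g).
Proof.
move=> [_ gac] t; apply/cvgrPdist_lt => e e0.
have sub : `[Num.min t t0 - 1, t0]%classic `<=` `]-oo, t0]%classic.
  by move=> z /=; rewrite !in_itv /= => /andP[].
have [d d0 dP] := ac_uniformly_continuous _ _ _ (gac _ _ sub) e e0.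
exists (Num.min d 1) => /=; first by rewrite lt_min d0 ltr01.
move=> s /=; rewrite lt_min => /andP[sd s1]; rewrite /vartheta.
have lip : `|Num.min t t0 - Num.min s t0| <= `|t - s|.
  have := ler_norm (t - s); have := ler_norm (s - t); rewrite (distrC s).
  rewrite ler_norml; case: (leP t t0); case: (leP s t0); lra.
have t0m : Num.min t t0 <= t0 by rewrite ge_min lexx orbT.
have s0m : Num.min s t0 <= t0 by rewrite ge_min lexx orbT.
have := le_lt_trans lip s1; rewrite ltr_norml => /andP[l1 l2].
apply: dP; last exact: le_lt_trans lip sd.
  by rewrite s0m; lra.
by rewrite t0m; lra.
Qed.

Lemma vartheta_id {R : realType} (t0 t : R) (g : R -> R) :
  t <= t0 -> vartheta t0 g t = g t.
Proof. by move=> tt0; rewrite /vartheta min_l. Qed.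

Lemma vartheta_near {R : realType} (t0 t : R) (g : R -> R) :
  t < t0 -> \near t, g t = vartheta t0 g t.
Proof.
move=> tt0; have : \forall s \near t, s < t0 by exact: lt_nbhsl.
by apply: filterS => s /ltW /vartheta_id ->.
Qed.

Lemma AC_loc_vartheta {R : realType} (t0 : R) (D : set R) (g : R -> R) :
  AC_loc `]-oo, t0] D g ->
  forall a b, b <= t0 -> absolutely_continuous a b (vartheta t0 g).
Proof.
move=> [_ gac] a b bt0.
have sub : `[a, b]%classic `<=` `]-oo, t0]%classic.
  by move=> z /=; rewrite !in_itv /= => /andP[_ zb]; lra.
apply: (ac_dominated g g _ _ _ 1) => //; [exact: gac|exact: gac|].
by move=> x y _ xy yb; rewrite !vartheta_id ?mul1r ?lerDl//; lra.
Qed.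

(** * Positive operators with memory *)

Lemma C_loc_comb {R : realType} (x y : R -> R) (c d : R) :
  C_loc R x -> C_loc R y -> C_loc R (fun s => c * x s + d * y s).
Proof.
move=> xc yc t; apply: cvgD; apply: cvgM.
- exact: cvg_cst.
- exact: xc.
- exact: cvg_cst.
- exact: yc.
Qed.

Lemma linear_operator_comb {R : realType} (T : operator R) (x y : R -> R)
  (c d : R) : linear_operator T -> C_loc R x -> C_loc R y ->
  {ae @lebesgue_measure R, forall t,
    T (fun s => c * x s + d * y s) t = c * T x t + d * T y t}.
Proof.
move=> Tlin xc yc.
have c0 : C_loc R (fun=> 0) by move=> t; exact: cvg_cst.
have dyc : C_loc R (fun s => d * y s + 0).
  by move=> t; apply: cvgD; [apply: cvgM; [exact: cvg_cst|exact: yc]|exact: cvg_cst].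
have H0 := Tlin 1 _ _ c0 c0; have Hd := Tlin d _ _ yc c0.
have := Tlin c _ _ xc dyc.
apply: filterS3 H0 Hd => t /=.
rewrite (_ : (fun=> 1 * 0 + 0) = (fun=> 0)); last first.
  by apply/funext => s; rewrite mul1r addr0.
rewrite mul1r => H0 -> H.
rewrite (_ : (fun s => c * x s + d * y s) = fun s => c * x s + (d * y s + 0)).
  by rewrite H; lra.
by apply/funext => s; rewrite addr0.
Qed.

Lemma max_continuous {R : realType} (v : R -> R) (m : R) :
  continuous v -> continuous (fun s => Num.max (v s) m).
Proof. by move=> vc t; apply: continuous_max; [exact: vc|exact: cvg_cst]. Qed.

(** By the Volterra property the values of [T v] up to [zeta] do not see [v] beyond
    [zeta], so [v] may be replaced by its positive part. *)
Lemma volterra_ge0 {R : realType} (T : operator R) (t0 zeta : R) (v : R -> R) :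
  positive_operator T -> V t0 T -> zeta <= t0 -> C_loc R v ->
  (forall s, s <= zeta -> 0 <= v s) ->
  {ae @lebesgue_measure R, forall t, t <= zeta -> 0 <= T v t}.
Proof.
move=> Tpos [_ TV] zt0 vc v0.
pose w s := Num.max (v s) 0.
have wc : C_loc R w by exact: max_continuous.
have w0 s : 0 <= w s by rewrite le_max lexx orbT.
have vw s : s <= zeta -> v s = w s by move=> /v0 vs; rewrite /w; case: leP vs; lra.
have H1 := Tpos _ wc w0; have H2 := TV _ zt0 _ _ vc wc vw.
by apply: filterS2 H1 H2 => t wt0 + tz => ->.
Qed.

(** On the delay window [v] agrees with the maximum of [v] and [m], which is at
    least [m] on the whole line. *)
Lemma delay_ge {R : realType} (T : operator R) (t0 : R) (sigma v : R -> R)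
  (m : R) :
  linear_operator T -> positive_operator T -> V_delay t0 sigma T ->
  C_loc R v ->
  {ae @lebesgue_measure R, forall t, t <= t0 ->
    (forall s, sigma t <= s <= t -> m <= v s) -> m * T (cst 1) t <= T v t}.
Proof.
move=> Tlin Tpos [_ TV] vc.
pose w s := Num.max (v s) m.
have wc : C_loc R w by exact: max_continuous.
have c1 : C_loc R (cst 1) by move=> t; exact: cvg_cst.
have wmc : C_loc R (fun s => 1 * w s + (- m) * cst 1 s).
  exact: C_loc_comb.
have wm0 s : 0 <= 1 * w s + (- m) * cst 1 s.
  have : m <= w s by rewrite le_max lexx orbT.
  by rewrite /cst; lra.
have H1 := linear_operator_comb _ _ _ 1 (- m) Tlin wc c1.
have H2 := Tpos _ wmc wm0; have H3 := TV _ _ vc wc.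
apply: filterS3 H1 H2 H3 => t -> H2 H3 tt0 vm.
rewrite H3//; first by lra.
by move=> s /vm ms; rewrite /w; case: leP ms => //; lra.
Qed.

(** For a fixed [zeta], the function [x zeta / y zeta * y - x] is nonnegative up to
    [zeta], hence [T x <= x zeta / y zeta * T y] almost everywhere up to [zeta].
    The exceptional set depends on [zeta]: only the countably many rational
    [zeta] are used, and [zeta] then decreases to [t] by continuity. *)
Lemma volterra_le_ratio {R : realType} (T : operator R) (t0 : R)
  (x y : R -> R) :
  linear_operator T -> positive_operator T -> V t0 T ->
  C_loc R x -> C_loc R y -> (forall t, t <= t0 -> 0 < y t) ->
  (forall s t, s <= t -> t <= t0 -> x s / y s <= x t / y t) ->
  {ae @lebesgue_measure R, forall t, t < t0 -> T x t <= x t / y t * T y t}.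
Proof.
move=> Tlin Tpos TV xc yc y0 xy.
have Hz zeta : zeta <= t0 -> {ae @lebesgue_measure R, forall t, t <= zeta ->
    T x t <= x zeta / y zeta * T y t}.
  move=> zt0; set c := x zeta / y zeta.
  have vc : C_loc R (fun s => c * y s + (- 1) * x s).
    exact: C_loc_comb.
  have v0 s : s <= zeta -> 0 <= c * y s + (- 1) * x s.
    move=> sz; have ys : 0 < y s by apply: y0; exact: le_trans zt0.
    by have := xy _ _ sz zt0; rewrite ler_pdivrMr// -/c; lra.
  have H1 := volterra_ge0 _ _ _ _ Tpos TV zt0 vc v0.
  have H2 := linear_operator_comb _ _ _ c (- 1) Tlin yc xc.
  by apply: filterS2 H1 H2 => t H1 H2 tz; have := H1 tz; rewrite H2; lra.
have Hq : {ae @lebesgue_measure R, forall t, forall n : nat,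
    if unpickle n is Some r then
      (ratr r : R) <= t0 -> t <= ratr r ->
      T x t <= x (ratr r) / y (ratr r) * T y t
    else True}.
  apply: ae_foralln => n; case: unpickle => [r|]; last exact: filterE.
  have [le|lt] := leP (ratr r : R) t0; last first.
    by apply: filterE => t le; exfalso; lra.
  by apply: filterS (Hz _ le) => t + _ => /[apply].
apply: filterS Hq => t Hq tt0; rewrite leNgt; apply/negP => lt.
have rc : x s / y s * T y t @[s --> t] --> x t / y t * T y t.
  apply: cvgM; last exact: cvg_cst.
  apply: cvgM; first exact: xc.
  by apply: cvgV; [rewrite gt_eqF// y0// ltW|exact: yc].
have e0 : 0 < T x t - x t / y t * T y t by rewrite subr_gt0.
move/cvgrPdist_lt : rc => /(_ _ e0)[d /= d0 dP].
have [r] : exists r : rat, ratr r \in `]t, Num.min t0 (t + d)[.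
  by apply: rat_in_itvoo; rewrite lt_min tt0 ltrDl.
rewrite in_itv /= lt_min => /and3P[tr rt0 rd].
have := Hq (pickle r); rewrite pickleK /= => /(_ (ltW rt0) (ltW tr)).
have := dP (ratr r); rewrite /ball_ /= ltr0_norm; last by lra.
move=> /(_ ltac:(lra)); rewrite ltr_norml => /andP[]; lra.
Qed.

(** * The two comparison principles *)

Lemma supersolution_nonincreasing {R : realType} (T : operator R) (t0 t1 : R)
  (w : R -> R) :
  positive_operator T -> V t0 T -> t1 <= t0 -> C_loc R w ->
  (forall a, absolutely_continuous a t1 w) ->
  (forall t, t <= t1 -> 0 <= w t) ->
  {ae @lebesgue_measure R, forall t, t < t1 ->
     exists2 d, is_derive t 1 w d & d <= - T w t} ->
  forall s, s <= t1 -> w t1 <= w s.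
Proof.
move=> Tpos TV t10 wc wac w0 wder s st; rewrite -lerN2.
apply: (ac_nondecreasing (fun x => - w x) s t1 st).
  apply: (ac_dominated w w _ _ _ 1) => // x y _ _ _.
  have -> : - w y - - w x = - (w y - w x) by ring.
  by rewrite normrN mul1r lerDl.
have H := volterra_ge0 _ _ _ _ Tpos TV t10 wc w0.
apply: filterS2 H wder => t Tw0 wder /andP[_ tt1].
have [d wd dle] := wder tt1; exists (- d); first exact: is_deriveN.
by have := Tw0 (ltW tt1); lra.
Qed.

(** Let [lam] be the supremum of [z / g] up to [t1] and [w = lam * g - z]. Then
    [w >= 0] up to [t1] and [w' <= - T w <= 0], so [w] is nonincreasing. Were
    [w t1 = eta] positive, [w] would be at least [eta] on the whole half-line,
    and then [z / g] would stay away from [lam]: where [g] is bounded because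
    [z <= lam * g - eta], where [g] is large because [z] is bounded. Hence
    [w t1 <= 0], that is, the supremum is reached at [t1]. *)
Lemma solution_ratio_nondecreasing {R : realType} (T : operator R) (t0 M : R)
  (z g : R -> R) :
  linear_operator T -> positive_operator T -> V t0 T ->
  C_loc R z -> C_loc R g ->
  (forall a b, b <= t0 -> absolutely_continuous a b z) ->
  (forall a b, b <= t0 -> absolutely_continuous a b g) ->
  (forall t, t <= t0 -> 0 <= z t <= M) ->
  (forall t, t <= t0 -> 0 < g t) ->
  {ae @lebesgue_measure R, forall t, t < t0 ->
     exists2 d, is_derive t 1 z d & - T z t <= d} ->
  {ae @lebesgue_measure R, forall t, t < t0 ->
     exists2 d, is_derive t 1 g d & d <= - T g t} ->
  forall s t, s <= t -> t <= t0 -> z s / g s <= z t / g t.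
Proof.
move=> Tlin Tpos TV zc gc zac gac zM g0 zder gder s t1 st1 t10.
have gdecr s' t' : s' <= t' -> t' <= t0 -> g t' <= g s'.
  move=> st tt; apply: (supersolution_nonincreasing T t0 t') => //.
  - by move=> a; exact: gac.
  - by move=> r rt; rewrite ltW// g0// (le_trans rt).
  - by apply: filterS gder => r + rt; apply; exact: lt_le_trans tt.
pose E := [set z s / g s | s in `]-oo, t1]].
have Et r : r <= t1 -> E (z r / g r) by move=> rt; exists r => //; rewrite /= in_itv.
have supE : has_sup E.
  split; first by exists (z s / g s); exact: Et.
  exists (M / g t1) => _ [r /= + <-]; rewrite in_itv /= => rt.
  have /andP[zr0 zrM] := zM _ (le_trans rt t10).
  have gr0 : 0 < g r by rewrite g0// (le_trans rt).
  apply: ler_pM => //; first by rewrite invr_ge0 ltW.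
  by rewrite lef_pV2 ?gdecr ?posrE // g0.
pose lam := sup E.
have lamP r : r <= t1 -> z r / g r <= lam.
  by move=> /Et Er; apply: ub_le_sup => //; case: supE.
have zlam r : r <= t1 -> z r <= lam * g r.
  by move=> rt; rewrite -ler_pdivrMr ?lamP// g0// (le_trans rt).
pose w r := lam * g r + (- 1) * z r.
suff wt1 : w t1 <= 0.
  apply: le_trans (lamP _ st1) _; rewrite ler_pdivlMr ?g0//.
  by move: wt1; rewrite /w; lra.
rewrite leNgt; apply/negP; set eta := w t1 => eta0.
have wc : C_loc R w by exact: C_loc_comb.
have weta r : r <= t1 -> eta <= w r.
  move: r; apply: (supersolution_nonincreasing T t0 t1 w) => //.
  - move=> a; apply: (ac_dominated g z _ _ _ (`|lam| + 1)).
    + by rewrite addr_ge0.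
    + exact: gac.
    + exact: zac.
    move=> x y _ _ _; rewrite /w.
    have -> : lam * g y + -1 * z y - (lam * g x + -1 * z x) =
      lam * (g y - g x) - (z y - z x) by ring.
    apply: le_trans (ler_normB _ _) _; rewrite normrM.
    have H1 : 0 <= `|lam| * `|z y - z x| by rewrite mulr_ge0.
    have := normr_ge0 (g y - g x).
    have -> : (`|lam| + 1) * (`|g y - g x| + `|z y - z x|) =
      `|lam| * `|g y - g x| + `|lam| * `|z y - z x| + `|g y - g x| + `|z y - z x|
      by ring.
    lra.
  - by move=> r /zlam; rewrite /w; lra.
  have H := linear_operator_comb _ _ _ lam (- 1) Tlin gc zc.
  apply: filterS3 H zder gder => r Hr zr gr rt1.
  have [|dz zD zle] := zr; first exact: lt_le_trans t10.
  have [|dg gD gle] := gr; first exact: lt_le_trans t10.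
  exists (lam * dg + (- 1) * dz).
    have lD := is_deriveZ lam gD; have mD := is_deriveZ (- 1) zD.
    exact: (is_deriveD lD mD).
  rewrite /w Hr; have lam0 : 0 <= lam.
    apply: le_trans (lamP _ (lexx t1)).
    by rewrite divr_ge0 ?(ltW (g0 _ t10))//; have /andP[] := zM _ t10.
  have := ler_wpM2l lam0 gle; lra.
have /andP[zt10 zt1M] := zM _ t10.
have lam_gt0 : 0 < lam.
  have : 0 < lam * g t1 by move: eta0; rewrite /eta /w; lra.
  by rewrite pmulr_lgt0// g0.
(* The threshold e serves both cases: the bound lam / 2 limits g r, and the
   other bound then makes e * g r at most eta. *)
pose M' := M + 1; have M'0 : 0 < M' by rewrite /M'; lra.
pose e := Num.min (lam / 2) (eta * lam / (2 * M')).
have e0 : 0 < e.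
  by rewrite lt_min !divr_gt0// ?mulr_gt0.
have [_ [r /= + <-]] := sup_adherent e0 supE; rewrite in_itv /= -/lam => rt.
have gr0 : 0 < g r by rewrite g0// (le_trans rt).
rewrite ltr_pdivlMr// => lt.
have := weta _ rt; rewrite /w => etale.
have /andP[_ zrM] := zM _ (le_trans rt t10).
have e1 : e <= lam / 2 by rewrite ge_min lexx.
have e2 : e <= eta * lam / (2 * M') by rewrite ge_min lexx orbT.
have H1 : (lam / 2) * g r <= M'.
  apply: (@le_trans _ _ ((lam - e) * g r)); first by rewrite ler_wpM2r ?(ltW gr0)//; lra.
  by rewrite /M'; lra.
have H2 : e * g r <= eta.
  apply: (@le_trans _ _ (eta * lam / (2 * M') * g r)).
    by rewrite ler_wpM2r// ltW.
  have -> : eta * lam / (2 * M') * g r = eta / M' * (lam / 2 * g r).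
    by field; rewrite gt_eqF.
  apply: (@le_trans _ _ (eta / M' * M')); last by rewrite divfK// gt_eqF.
  by rewrite ler_wpM2l// divr_ge0// ltW.
lra.
Qed.

(** A Harnack inequality: moving to the right, [z] keeps a fixed proportion of its
    value. With [m = 0] the hypothesis reads [z' >= - q * z], which settles the
    case where the integral of [q] from [s] is at most [K + 1]. Otherwise suppose
    that [z] falls below [expR (- (K + 1)) * z s], and let [c] be a point where it
    is minimal on [`[s, t]]. Let [b] be the point where the integral from [s]
    equals [K + 1]. Beyond [b] the delay windows, of weight at most [K], lie to
    the right of [s], where [z >= z c]; so [z' >= q * (z c - z)] on [`[b, c]], and
    [z b > z c] forces [z c > z c]. *)
Lemma delay_harnack {R : realType} (z q sigma : R -> R) (t0 K M : R) :
  C_loc R z -> (forall a b, b <= t0 -> absolutely_continuous a b z) ->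
  (forall t, t <= t0 -> 0 <= z t <= M) ->
  (forall t, 0 <= q t) -> locally_integrable setT q ->
  (forall t, t <= t0 -> \int[@lebesgue_measure R]_(s in `[sigma t, t]) q s <= K) ->
  (forall m, 0 <= m -> {ae @lebesgue_measure R, forall t, t < t0 ->
     (forall s, sigma t <= s <= t -> m <= z s) ->
     exists2 d, is_derive t 1 z d & q t * (m - z t) <= d}) ->
  forall s t, s <= t -> t <= t0 -> expR (- (K + 1)) * z s <= z t.
Proof.
move=> zc zac zM q0 qi qK zder s t st tt0; rewrite leNgt; apply/negP => zt.
have K0 : 0 <= K by apply: le_trans (qK _ tt0); exact: Rintegral_ge0.
have [c cst cmin] : exists2 c, c \in `[s, t] & forall r, r \in `[s, t] -> z c <= z r.
  by apply: EVT_min => //; apply: continuous_subspaceT => r; exact: zc.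
move: cst; rewrite in_itv /= => /andP[sc ct].
have ct0 : c <= t0 by exact: le_trans tt0.
pose P x := \int[@lebesgue_measure R]_(r in `[s, x]) q r.
have PP x y : x <= y -> P x <= P y by move=> xy; exact: le_Rintegral_subitv.
have Ps : P s = 0 by rewrite /P set_itv1 Rintegral_set1.
have /andP[zc0 _] := zM _ ct0.
have zcd : z c < expR (- (K + 1)) * z s.
  by apply: le_lt_trans zt; apply: cmin; rewrite in_itv /= st lexx.
have zgrow x : s <= x -> x <= t0 -> z s * expR (- P x) <= z x.
  move=> sx xt0; have := gronwall_lower z q 0 M s s x (lexx s) sx q0 qi.
  rewrite -!/(P _) Ps expR0 !subr0 mulr1.
  move=> H; have {H} : z s <= z x * expR (P x).
    apply: H; first exact: zac.
      move=> r /andP[_ rx]; have /andP[? ?] := zM _ (le_trans rx xt0).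
      by rewrite subr0 ger0_norm.
    apply: filterS (zder 0 (lexx 0)) => r zr /andP[sr rx].
    have rt0 : r < t0 by exact: lt_le_trans xt0.
    apply: zr => // s' /andP[_ s'r].
    by have /andP[] := zM _ (le_trans s'r (ltW rt0)).
  by rewrite expRN ler_pdivrMr ?expR_gt0.
have Pc : K + 1 < P c.
  rewrite ltNge; apply/negP => Pc; have := zgrow _ sc ct0.
  apply/negP; rewrite -ltNge (lt_le_trans zcd)// mulrC ler_wpM2l//.
    by have /andP[] := zM _ (le_trans st tt0).
  by rewrite ler_expR lerN2.
have [b] : exists2 b, b \in `[s, c] & P b = K + 1.
  apply: IVT => //.
    by apply: parameterized_integral_continuous => //; exact: locally_integrable_itv.
  by rewrite Ps; case: (leP 0 (P c)); lra.
rewrite in_itv /= => /andP[sb bc] Pb.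
have zb : z c < z b.
  apply: lt_le_trans zcd _; apply: le_trans (zgrow b sb (le_trans bc ct0)).
  by rewrite Pb mulrC.
have := gronwall_lower z q (z c) (M + M) s b c sb bc q0 qi.
rewrite -!/(P _) subrr mul0r => H; have {H} : (z b - z c) * expR (P b) <= 0.
  apply: H; first exact: zac.
    move=> r /andP[_ rc]; have /andP[? ?] := zM _ (le_trans rc ct0).
    have /andP[? ?] := zM _ ct0.
    by rewrite ler_norml; lra.
  apply: filterS (zder _ zc0) => r zr /andP[br rc].
  have rt0 : r < t0 by exact: lt_le_trans ct0.
  apply: zr => // s' /andP[sigs s'r]; apply: cmin; rewrite in_itv /=.
  apply/andP; split; last by lra.
  (* A window reaching below s would carry all the weight between s and r, which
     is at least K + 1. *)
  rewrite leNgt; apply/negP => s's; have := qK _ (ltW rt0).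
  apply/negP; rewrite -ltNge; apply: (@lt_le_trans _ _ (P r)).
    by apply: (@lt_le_trans _ _ (P b)); [rewrite Pb; lra|apply: PP; exact: ltW].
  by apply: le_Rintegral_subitv => //; lra.
by apply/negP; rewrite -ltNge mulr_gt0 ?expR_gt0// subr_gt0.
Qed.

(** * Existence of the limit *)

(** Since [u] comes arbitrarily close to its infimum [m] at some point, the Harnack
    inequality for [u - m] keeps it close to [m] everywhere to the left. *)
Lemma cvg_ninfty_inf {R : realType} (u : R -> R) (t0 m c : R) :
  0 < c -> (forall t, t <= t0 -> m <= u t) ->
  (forall e, 0 < e -> exists2 t, t <= t0 & u t < m + e) ->
  (forall s t, s <= t -> t <= t0 -> c * (u s - m) <= u t - m) ->
  u t @[t --> -oo] --> m.
Proof.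
move=> c0 mu adh har; apply/cvgrPdist_lt => e e0.
have [t tt0 ut] := adh _ (mulr_gt0 c0 e0).
exists t; split => [|s st]; first exact: num_real.
have H := har _ _ (ltW st) tt0.
have {}H : c * (u s - m) < c * e by lra.
rewrite ltr_pM2l// in H.
by rewrite distrC ger0_norm ?subr_ge0 ?mu// ltW// (lt_le_trans st).
Qed.

Lemma ae_and {R : realType} (P Q : R -> Prop) :
  {ae @lebesgue_measure R, forall t, P t} ->
  {ae @lebesgue_measure R, forall t, Q t} ->
  {ae @lebesgue_measure R, forall t, P t /\ Q t}.
Proof. exact: filterS2. Qed.

Theorem theorem2p8 (R : realType) (l0 l1 f : operator R)
    (l0_continuous : continuous_operator l0)
    (l0_linear : linear_operator l0)
    (l0_positive : positive_operator l0)
    (l1_continuous : continuous_operator l1)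
    (l1_linear : linear_operator l1)
    (l1_positive : positive_operator l1)
    (f_continuous : continuous_operator f)
    (f_caratheodory : local_caratheodory f)
    (t0 : R) (l1_V : V t0 l1)
    (sigma : R -> R) (sigmaP : Sigma R sigma) (l0_V : V_delay t0 sigma l0)
    (kappa : R) (kappa_gt0 : 0 < kappa)
    (f_ge0 : forall v : R -> R, C_0 `[0, kappa] v ->
      {ae @lebesgue_measure R, forall t : R, t <= t0 -> 0 <= f v t})
    (gamma : R -> R) (gammaP : AC_loc `]-oo, t0] `]0, +oo[ gamma)
    (gamma_derive : {ae @lebesgue_measure R, forall t : R, t <= t0 ->
      [/\ derivable gamma t 1,
          gamma^`()%classic t <= - l1 (vartheta t0 gamma) t &
          l0 (cst 1) t >= l1 (vartheta t0 gamma) t / gamma t]})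
    (gamma_int : (ereal_sup
      [set \int[@lebesgue_measure R]_(s in `[sigma t, t])
             (l1 (vartheta t0 gamma) s / gamma s)%:E | t in `]-oo, t0]]
      < +oo)%E)
    (u : R -> R) (u_solution : solution l0 l1 f t0 u)
    (u_bounds : forall t : R, t <= t0 -> 0 <= u t <= kappa) :
  exists l : R, u t @[t --> -oo] --> l.
Proof.
have [uAC uder] := u_solution.
set G := vartheta t0 gamma in gamma_derive gamma_int.
set U := vartheta t0 u in uder.
have Gc : C_loc R G by exact: AC_loc_vartheta_continuous gammaP.
have Uc : C_loc R U by exact: AC_loc_vartheta_continuous uAC.
have Gac := AC_loc_vartheta _ _ _ gammaP; rewrite -/G in Gac.
have Uac := AC_loc_vartheta _ _ _ uAC; rewrite -/U in Uac.
have c1 : C_loc R (cst 1) by move=> t; exact: cvg_cst.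
have mint t : Num.min t t0 <= t0 by rewrite ge_min lexx orbT.
have G0 t : 0 < G t.
  by have := gammaP.1 (Num.min t t0); rewrite /= !in_itv /= andbT; apply.
have U0k t : 0 <= U t <= kappa by exact: u_bounds.
have gG t : t <= t0 -> G t = gamma t by exact: vartheta_id.
have uU t : t <= t0 -> U t = u t by exact: vartheta_id.
have Gder : {ae @lebesgue_measure R, forall t, t < t0 ->
    exists2 d, is_derive t 1 G d & d <= - l1 G t}.
  apply: filterS gamma_derive => t H tt0; have [dg gle _] := H (ltW tt0).
  exists (gamma^`()%classic t) => //.
  apply: (near_eq_is_derive (vartheta_near _ _ gamma tt0)).
  by split => //; rewrite derive1E.
have l1G0 := l1_positive _ Gc (fun t => ltW (G0 t)).
have Gdecr s t : s <= t -> t <= t0 -> G t <= G s.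
  move=> st tt0.
  apply: (supersolution_nonincreasing l1 t0 t G) => // [a|r _|].
  - exact: Gac.
  - exact: ltW.
  - by apply: filterS Gder => r + rt; apply; exact: lt_le_trans tt0.
have GGt0 t : G t0 <= G t.
  have -> : G t = G (Num.min t t0) by rewrite /G /vartheta -minA minxx.
  exact: Gdecr.
(* The weight l1 gamma / gamma, changed on a null set and beyond t0 so as to be
   nonnegative and locally integrable on the whole line. *)
pose q t := (G t)^-1 * `|l1 G t|.
have q0 t : 0 <= q t by rewrite mulr_ge0// invr_ge0 ltW.
have mGV : measurable_fun setT (fun t => (G t)^-1).
  apply: continuous_measurable_fun => t; apply: cvgV; last exact: Gc.
  by rewrite gt_eqF.
have l1Gi : locally_integrable setT (l1 G) by exact: l1_continuous.1.
have qi : locally_integrable setT q.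
  apply: (locally_integrable_mul_norm _ _ (G t0)^-1 l1Gi mGV) => t.
  by rewrite invr_ge0 ltW//= lef_pV2 ?posrE.
have ql1 : {ae @lebesgue_measure R, forall t, q t = l1 G t / G t}.
  by apply: filterS l1G0 => t l1t; rewrite /q ger0_norm// mulrC.
have [K qK] : exists K : R, forall t, t <= t0 ->
    \int[@lebesgue_measure R]_(s in `[sigma t, t]) q s <= K.
  move: gamma_int; set S := ereal_sup _ => Soo.
  have qS t : t <= t0 ->
      (\int[@lebesgue_measure R]_(s in `[sigma t, t]) (q s)%:E <= S)%E.
    move=> tt0; apply: ereal_sup_ubound; exists t; first by rewrite /= in_itv.
    transitivity (\int[@lebesgue_measure R]_(s in `[sigma t, t])
                    (l1 G s / G s)%:E)%E.
      apply: eq_integral => s; rewrite inE /= in_itv /= => /andP[_ st].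
      by rewrite gG//; exact: le_trans tt0.
    have mq : measurable_fun setT q by case: qi.
    apply: ae_eq_integral => //.
    - apply/measurable_EFinP; apply: measurable_funTS.
      by apply: measurable_funM => //; case: l1Gi.
    - by apply/measurable_EFinP; exact: measurable_funTS.
    - by apply: filterS ql1 => s -> _.
  have S0 : (0 <= S)%E.
    by apply: le_trans (qS t0 (lexx _)); apply: integral_ge0 => s _; rewrite lee_fin.
  exists (fine S) => t tt0; apply: fine_le; last exact: qS.
  - by apply: integrable_fin_num => //; exact: locally_integrable_itv.
  - by rewrite ge0_fin_numE.
(* The limit is the infimum a of u; z is the extension of u - a. *)
pose E := [set u t | t in `]-oo, t0]].
have infE : has_inf E.
  split; first by exists (u t0); exists t0 => //=; rewrite in_itv /=.
  exists 0 => _ [t /= + <-]; rewrite in_itv /= => tt0.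
  by have /andP[] := u_bounds _ tt0.
pose a := inf E.
have au t : t <= t0 -> a <= u t.
  move=> tt0; apply: ge_inf; first by case: infE.
  by exists t => //=; rewrite in_itv.
have a0 : 0 <= a.
  apply: lb_le_inf; first by case: infE.
  move=> _ [t /= + <-]; rewrite in_itv /= => tt0.
  by have /andP[] := u_bounds _ tt0.
pose z s := 1 * U s + (- a) * cst 1 s.
have zE s : z s = U s - a by rewrite /z /cst; lra.
have zc : C_loc R z by exact: C_loc_comb.
have zac b c : c <= t0 -> absolutely_continuous b c z.
  move=> ct0; apply: (ac_dominated U U _ _ _ 1) => //; [exact: Uac|exact: Uac|].
  move=> x y _ _ _; rewrite !zE mul1r.
  by rewrite (_ : U y - a - (U x - a) = U y - U x) ?lerDl//; ring.
have z0 t : 0 <= z t by rewrite zE subr_ge0 au.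
have zk t : 0 <= z t <= kappa.
  by rewrite z0 /= zE; have /andP[_] := U0k t; lra.
have fU0 : {ae @lebesgue_measure R, forall t, t <= t0 -> 0 <= f U t}.
  apply: f_ge0; split => //.
  exists kappa; split; first exact: num_real.
  move=> x kx t _ /=; have /andP[U0 Uk] := U0k t.
  by rewrite ger0_norm// (le_trans Uk)// ltW.
have l11 : {ae @lebesgue_measure R, forall t, t < t0 ->
    l1 (cst 1) t <= cst 1 t / G t * l1 G t}.
  apply: (volterra_le_ratio l1 t0) => // s t st tt0.
  by rewrite !mul1r lef_pV2 ?posrE// Gdecr.
have l0z := linear_operator_comb _ _ _ 1 (- a) l0_linear Uc c1.
have l1z := linear_operator_comb _ _ _ 1 (- a) l1_linear Uc c1.
(* The constant a contributes a * (l0 1 - l1 1), nonnegative because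
   l1 1 <= l1 gamma / gamma <= l0 1. *)
have zder : {ae @lebesgue_measure R, forall t, t < t0 ->
    exists2 d, is_derive t 1 z d & l0 z t - l1 z t <= d}.
  apply: filterS3 (ae_and _ _ (ae_and _ _ l0z l1z) l11) (ae_and _ _ fU0 uder)
    (ae_and _ _ ql1 gamma_derive).
  move=> t [[l0zE l1zE] l11t] [fUt uDt] [qt gDt] tt0.
  have [_ _ l01] := gDt (ltW tt0).
  exists (l0 U t - l1 U t + f U t).
    have := near_eq_is_derive (vartheta_near _ _ u tt0) (uDt (ltW tt0)).
    rewrite -/U => UD; have := is_deriveB UD (is_derive_cst a t 1).
    rewrite subr0; congr is_derive; apply/funext => s; exact/esym/zE.
  rewrite -(gG _ (ltW tt0)) in l01.
  have {}l11t := l11t tt0; rewrite mul1r mulrC in l11t.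
  have := ler_wpM2l a0 (le_trans l11t l01); have := fUt (ltW tt0).
  by move: l0zE l1zE; rewrite -/z => -> ->; lra.
have l0z0 := l0_positive _ zc z0.
have ratio : forall s t, s <= t -> t <= t0 -> z s / G s <= z t / G t.
  apply: (solution_ratio_nondecreasing l1 t0 kappa z G) => //.
  apply: filterS2 l0z0 zder => t l00 H tt0.
  by have [d zd dle] := H tt0; exists d => //; lra.
have l1z_le := volterra_le_ratio l1 t0 z G l1_linear l1_positive l1_V zc Gc
  (fun t _ => G0 t) ratio.
have har := delay_harnack z q sigma t0 K kappa zc zac (fun t _ => zk t) q0 qi qK.
exists a; apply: (cvg_ninfty_inf u t0 a (expR (- (K + 1)))) => //.
- exact: expR_gt0.
- move=> e e0; have [_ [t /= + <-] lt] := inf_adherent e0 infE.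
  by rewrite in_itv /= => tt0; exists t.
- move=> s t st tt0; rewrite -!uU// -?zE; last exact: le_trans tt0.
  apply: har => // m m0.
  have l0z_ge := delay_ge l0 t0 sigma z m l0_linear l0_positive l0_V zc.
  apply: filterS3 (ae_and _ _ l0z_ge zder) (ae_and _ _ ql1 l1z_le) gamma_derive.
  move=> r [l0r zr] [qr l1r] gr rt0 mz.
  have [_ _ l01] := gr (ltW rt0); rewrite -(gG _ (ltW rt0)) -qr in l01.
  have [d zd dle] := zr rt0; exists d => //.
  have := l0r (ltW rt0) mz; have := ler_wpM2l m0 l01.
  have := l1r rt0; rewrite -mulrA [_^-1 * _]mulrC -qr; lra.
Qed.
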